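(* Let $G$ be a group. (i) Let $M,N$ be $G$-modules and let $h:C(G,M)\otimes C(G,N)\to C(G,M\otimes N)[-1]$ be the linear map such that, for $a\in C^p(G,M)$ and $b\in C^q(G,N)$, the cochain $h(a\otimes b)\in C^n(G,M\otimes N)$, with $n=p+q-1$, is defined by $h(a\otimes b)=0$ if $p=0$ or $q=0$ and, if $p,q>0$, by $$(s_0,\ldots,s_n)\mapsto(-1)^{pq+q}\sum_{i=0}^{p-1}(-1)^{(q+1)i}a(s_0,\ldots,s_i,s_{i+q},\ldots,s_n)\otimes b(s_i,\ldots,s_{i+q}).$$ Then for all $p,q\ge0$, $a\in C^p(G,M)$ and $b\in C^q(G,N)$, $$(-1)^{pq}t_*(b\cup a)-a\cup b=(hd+dh)(a\otimes b).$$ (ii) In terms of inhomogeneous cochains, $h(a\otimes b)$ for $p,q>0$ is given by $$(s_1,\ldots,s_n)\mapsto(-1)^{pq+q}\sum_{i=0}^{p-1}(-1)^{(q+1)i}a(s_1,\ldots,s_i,s_{i+1}\cdots s_{i+q},s_{i+q+1},\ldots,s_{p+q-1})\otimes s_1\cdots s_i\,b(s_{i+1},\ldots,s_{i+q}).$$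
   Context: Tensor products are over $\mathbb{Z}$, with diagonal $G$-action. $F$ is the standard resolution of $\mathbb{Z}$ over $\mathbb{Z}G$: $F_n=\mathbb{Z}G^{n+1}$ for $n\ge0$, with $u(s_0,\ldots,s_n)=(us_0,\ldots,us_n)$ and $\partial(s_0,\ldots,s_n)=\sum_{i=0}^n(-1)^i(s_0,\ldots,\hat s_i,\ldots,s_n)$. The complex of homogeneous cochains is $C(G,M)=\mathrm{Hom}_G(F,M)$, $C^n(G,M)=\mathrm{Hom}_G(F_n,M)$ ($C^{-1}=0$), with $(da)(x)=a(\partial x)$ (no sign). $C(G,M\otimes N)[-1]^n=C^{n-1}(G,M\otimes N)$. On $C(G,M)\otimes C(G,N)$, $d(a\otimes b)=da\otimes b+(-1)^pa\otimes db$ for $a\in C^p(G,M)$. The cup product of $a\in C^p(G,M)$ and $b\in C^q(G,N)$ is $(a\cup b)(s_0,\ldots,s_{p+q})=a(s_0,\ldots,s_p)\otimes b(s_p,\ldots,s_{p+q})$. The map $t:N\otimes M\to M\otimes N$ is $\beta\otimes\alpha\mapsto\alpha\otimes\beta$, and $t_*(c)=t\circ c$. Inhomogeneous $n$-cochains are functions $a:G^n\to M$. The inhomogeneous cochain $a$ corresponds to the homogeneous cochain $\bar a$ given by $\bar a(t_0,\ldots,t_n)=t_0\,a(t_0^{-1}t_1,\ldots,t_{n-1}^{-1}t_n)$; conversely $a(s_1,\ldots,s_n)=\bar a(t_0,\ldots,t_n)$ with $t_i=s_1\cdots s_i$, $t_0=1$. Part (ii) describes the map on inhomogeneous cochains obtained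 by transporting the homogeneous $h$ of part (i) through this isomorphism. *)

(* Defs.v *)
From HB Require Import structures.
From mathcomp Require Import all_boot all_algebra.
From mathcomp Require Import boolp functions.
From mathcomp.multinomials Require Export freeg.

Set Implicit Arguments.
Unset Strict Implicit.
Unset Printing Implicit Defensive.

Import GRing.Theory.
Local Open Scope ring_scope.

HB.mixin Record isGModule (G : groupType) M of GRing.Zmodule M := {
  gact : G -> M -> M;
  gact1 : forall x, gact 1%g x = x;
  gactM : forall u v x, gact (u * v)%g x = gact u (gact v x);
  gactD : forall u, {morph gact u : x y / x + y}
}.

#[short(type="gmodType")]
HB.structure Definition GModule (G : groupType) :=
  {M of GRing.Zmodule M & isGModule G M}.

Section GActTheory.
Context (G : groupType) (M : gmodType G).

Lemma gact0 (u : G) : gact u (0 : M) = 0.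
Proof. by apply: (addrI (gact u 0)); rewrite -gactD !addr0. Qed.

Lemma gact_is_nmod_morphism (u : G) : nmod_morphism (@gact G M u).
Proof. by split; [exact: gact0 | exact: gactD]. Qed.

HB.instance Definition _ (u : G) :=
  GRing.isNmodMorphism.Build M M (@gact G M u) (gact_is_nmod_morphism u).

End GActTheory.

Section FreeAbelianGroup.
Context (K : choiceType) (V : zmodType).

Definition zlift (f : K -> V) (x : {freeg K}) : V :=
  fglift (f : K -> zmodule V) x.

Lemma zlift_is_zmod_morphism (f : K -> V) : zmod_morphism (zlift f).
Proof. exact: (@lift_is_additive int K (zmodule V) f). Qed.

HB.instance Definition _ (f : K -> V) :=
  GRing.isZmodMorphism.Build {freeg K} V (zlift f) (zlift_is_zmod_morphism f).

Lemma zliftU (f : K -> V) k : zlift f << k >> = f k.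
Proof. by rewrite /zlift liftU scale1r. Qed.

Lemma zlift_ext (f g : {additive {freeg K} -> V}) :
  (forall k, f << k >> = g << k >>) -> f =1 g.
Proof.
move=> fg x; rewrite -(freeg_sumE x) !raddf_sum; apply: eq_bigr => k _.
by rewrite -[coeff k x]intz -freegU_mulz !raddfMz fg.
Qed.

End FreeAbelianGroup.

Section Tensor.
Context (M N : zmodType).

Inductive tensor_rel : {freeg (M * N)%type} -> Prop :=
| tensor_rel0 : tensor_rel 0
| tensor_relB x y : tensor_rel x -> tensor_rel y -> tensor_rel (x - y)
| tensor_relDl m m' n :
    tensor_rel (<< (m + m', n) >> - << (m, n) >> - << (m', n) >>)
| tensor_relDr m n n' :
    tensor_rel (<< (m, n + n') >> - << (m, n) >> - << (m, n') >>).

Definition tensor_pred : {pred {freeg (M * N)%type}} :=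
  fun x => `[< tensor_rel x >].

Lemma tensor_pred_closed : zmod_closed tensor_pred.
Proof.
split; first by apply/asboolP; exact: tensor_rel0.
by move=> x y /asboolP xR /asboolP yR; apply/asboolP; exact: tensor_relB.
Qed.

HB.instance Definition _ :=
  GRing.isZmodClosed.Build {freeg (M * N)%type} tensor_pred tensor_pred_closed.

Definition tensor : Type := Quotient.quot tensor_pred.

HB.instance Definition _ := GRing.Zmodule.on tensor.

Definition tpi (x : {freeg (M * N)%type}) : tensor :=
  \pi_(Quotient.quot tensor_pred)%qT x.

Lemma tpi_is_zmod_morphism : zmod_morphism tpi.
Proof. by move=> x y; rewrite /tpi raddfB. Qed.

HB.instance Definition _ :=
  GRing.isZmodMorphism.Build {freeg (M * N)%type} tensor tpi
    tpi_is_zmod_morphism.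

Definition tens (m : M) (n : N) : tensor := tpi << (m, n) >>.

End Tensor.

Section TensorTheory.
Context (M N V : zmodType).
Implicit Types (m : M) (n : N).

Lemma tensDl m m' n : tens (m + m') n = tens m n + tens m' n.
Proof.
apply/eqP; rewrite -subr_eq0 opprD addrA -!raddfB -(raddf0 (@tpi M N)).
by apply/eqP/eqquotP; rewrite Quotient.equivE subr0; apply/asboolP;
  exact: tensor_relDl.
Qed.

Lemma tensDr m n n' : tens m (n + n') = tens m n + tens m n'.
Proof.
apply/eqP; rewrite -subr_eq0 opprD addrA -!raddfB -(raddf0 (@tpi M N)).
by apply/eqP/eqquotP; rewrite Quotient.equivE subr0; apply/asboolP;
  exact: tensor_relDr.
Qed.

Lemma tens_is_nmod_morphism m : nmod_morphism (@tens M N m).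
Proof.
split; last exact: tensDr.
by apply: (addrI (tens m 0)); rewrite -tensDr !addr0.
Qed.

HB.instance Definition _ m :=
  GRing.isNmodMorphism.Build N (tensor M N) (@tens M N m)
    (tens_is_nmod_morphism m).

Definition tensr n m : tensor M N := tens m n.

Lemma tensr_is_nmod_morphism n : nmod_morphism (tensr n).
Proof.
split=> [|m m']; last exact: tensDl.
by apply: (addrI (tens 0 n)); rewrite /tensr -tensDl !addr0.
Qed.

HB.instance Definition _ n :=
  GRing.isNmodMorphism.Build M (tensor M N) (tensr n)
    (tensr_is_nmod_morphism n).

Lemma tensor_ext (f g : {additive tensor M N -> V}) :
  (forall m n, f (tens m n) = g (tens m n)) -> f =1 g.
Proof.
move=> fg t; rewrite -[t]reprK.
by apply: (@zlift_ext _ _ (f \o @tpi M N) (g \o @tpi M N)) => -[m n]; exact: fg.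
Qed.

Definition biadditive (b : M -> N -> V) : Prop :=
  (forall n, {morph b^~ n : m m' / m + m'}) /\
  (forall m, {morph b m : n n' / n + n'}).

Definition tlift (b : M -> N -> V) (t : tensor M N) : V :=
  zlift (fun x => b x.1 x.2) (repr t).

Lemma tlift_tpi b x : biadditive b ->
  tlift b (tpi x) = zlift (fun x => b x.1 x.2) x.
Proof.
move=> [bDl bDr]; rewrite /tlift.
set f := zlift _; apply/eqP; rewrite -subr_eq0 -raddfB.
have : (repr (tpi x) - x) \in @tensor_pred M N.
  by rewrite -Quotient.equivE; apply/eqquotP; exact: reprK.
move/asboolP; elim => [|y z _ /eqP fy _ /eqP fz|m m' n|m n n'].
- by rewrite raddf0.
- by rewrite raddfB fy fz subr0.
- by rewrite !raddfB /f /= !zliftU /= bDl addrAC addrK subrr.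
- by rewrite !raddfB /f /= !zliftU /= bDr addrAC addrK subrr.
Qed.

Lemma tlift_tens b m n : biadditive b -> tlift b (tens m n) = b m n.
Proof. by move=> bP; rewrite tlift_tpi // zliftU. Qed.

Lemma tlift_is_zmod_morphism b : biadditive b -> zmod_morphism (tlift b).
Proof.
move=> bP s t; rewrite -[s]reprK -[t]reprK.
by rewrite -[LHS]/(tlift b (tpi _ - tpi _)) -raddfB !tlift_tpi // raddfB.
Qed.

End TensorTheory.

Section TensorMap.
Context (M N M' N' : zmodType).
Context (f : {additive M -> M'}) (g : {additive N -> N'}).

Definition tmap : tensor M N -> tensor M' N' :=
  tlift (fun m n => tens (f m) (g n)).

Lemma tmap_biadditive : biadditive (fun m n => tens (f m) (g n)).
Proof. by split=> ? ? ?; rewrite raddfD (tensDl, tensDr). Qed.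

Lemma tmap_tens m n : tmap (tens m n) = tens (f m) (g n).
Proof. exact: tlift_tens tmap_biadditive. Qed.

HB.instance Definition _ :=
  GRing.isZmodMorphism.Build (tensor M N) (tensor M' N') tmap
    (tlift_is_zmod_morphism tmap_biadditive).

End TensorMap.

Section TensorGModule.
Context (G : groupType) (M N : gmodType G).

Definition tact (u : G) : tensor M N -> tensor M N :=
  tmap (@gact G M u) (@gact G N u).

HB.instance Definition _ (u : G) := GRing.Additive.on (tact u).

Lemma tact1 t : tact 1%g t = t.
Proof.
apply: (@tensor_ext _ _ _ (tact 1%g) idfun) => m n.
by rewrite /= /tact tmap_tens /= !gact1.
Qed.

Lemma tactM u v t : tact (u * v)%g t = tact u (tact v t).
Proof.
apply: (@tensor_ext _ _ _ (tact (u * v)%g) (tact u \o tact v)) => m n.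
by rewrite /= /tact !tmap_tens /= !gactM.
Qed.

Lemma tactD u : {morph tact u : s t / s + t}.
Proof. exact: raddfD. Qed.

HB.instance Definition _ :=
  isGModule.Build G (tensor M N) tact1 tactM tactD.

Lemma gact_tens u (m : M) (n : N) :
  gact u (tens m n) = tens (gact u m) (gact u n).
Proof. exact: tmap_tens. Qed.

End TensorGModule.

Section Hom.
Context (G : groupType).

Definition homG_pred (A M : gmodType G) : {pred A -> M} :=
  fun f => `[< zmod_morphism f /\ forall u x, f (gact u x) = gact u (f x) >].

Lemma homG_pred_closed (A M : gmodType G) : zmod_closed (@homG_pred A M).
Proof.
split.
  apply/asboolP; split=> [x y|u x]; first by rewrite subr0.
  by rewrite raddf0.
move=> f g /asboolP[fB fG] /asboolP[gB gG]; apply/asboolP; split=> [x y|u x].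
  by rewrite /= -[LHS]/(f (x - y) - g (x - y)) fB gB !opprD !addrA
    (addrAC _ (- f y)).
by rewrite -[LHS]/(f (gact u x) - g (gact u x)) fG gG -raddfB.
Qed.

HB.instance Definition _ (A M : gmodType G) :=
  GRing.isZmodClosed.Build (A -> M) (@homG_pred A M) (@homG_pred_closed A M).

Record homG (A M : gmodType G) := HomG {
  homG_fun :> A -> M;
  _ : homG_fun \in @homG_pred A M
}.

HB.instance Definition _ (A M : gmodType G) := [isSub for @homG_fun A M].
HB.instance Definition _ (A M : gmodType G) := [Choice of homG A M by <:].
HB.instance Definition _ (A M : gmodType G) :=
  [SubChoice_isSubZmodule of homG A M by <:].

Section HomTheory.
Context (A B : gmodType G).

Lemma homG_is_zmod_morphism (f : homG A B) : zmod_morphism f.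
Proof. by case: f => f /= /asboolP[]. Qed.

HB.instance Definition _ (f : homG A B) :=
  GRing.isZmodMorphism.Build A B f (homG_is_zmod_morphism f).

Lemma homG_gact (f : homG A B) u x : f (gact u x) = gact u (f x).
Proof. by case: f => f /= /asboolP[_ ->]. Qed.

End HomTheory.

Section HomComp.
Context (A B C : gmodType G).

Lemma homG_comp_subproof (g : homG B C) (f : homG A B) :
  g \o f \in @homG_pred A C.
Proof.
by apply/asboolP; split=> [x y|u x] /=; [rewrite !raddfB | rewrite !homG_gact].
Qed.

Definition homG_comp (g : homG B C) (f : homG A B) : homG A C :=
  HomG (homG_comp_subproof g f).

End HomComp.
End Hom.

Section Resolution.
Context (G : groupType) (n : nat).

Definition resolution : Type := {freeg (n.+1).-tuple G}.

HB.instance Definition _ := GRing.Zmodule.on resolution.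

Definition simplex (s : n.+1.-tuple G) : resolution := << s >>.

Definition tuple_act (u : G) (s : n.+1.-tuple G) : n.+1.-tuple G :=
  [tuple of [seq (u * x)%g | x <- s]].

Definition ract (u : G) : resolution -> resolution :=
  zlift (fun s => simplex (tuple_act u s)).

HB.instance Definition _ (u : G) := GRing.Additive.on (ract u).

Lemma ract_simplex u s : ract u (simplex s) = simplex (tuple_act u s).
Proof. exact: zliftU. Qed.

Lemma ract1 x : ract 1%g x = x.
Proof.
apply: (@zlift_ext _ _ (ract 1%g) idfun) => s.
rewrite [LHS]ract_simplex; congr << _ >>; apply: val_inj => /=.
by rewrite -[RHS]map_id; apply: eq_map => g; rewrite mul1g.
Qed.

Lemma ractM u v x : ract (u * v)%g x = ract u (ract v x).
Proof.
apply: (@zlift_ext _ _ (ract (u * v)%g) (ract u \o ract v)) => s.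
rewrite [LHS]ract_simplex /= [ract v _]ract_simplex ract_simplex.
congr << _ >>; apply: val_inj => /=; rewrite -map_comp.
by apply: eq_map => g; rewrite /= mulgA.
Qed.

Lemma ractD u : {morph ract u : x y / x + y}.
Proof. exact: raddfD. Qed.

HB.instance Definition _ := isGModule.Build G resolution ract1 ractM ractD.

Lemma gact_simplex u s : gact u (simplex s) = simplex (tuple_act u s).
Proof. exact: ract_simplex. Qed.

Lemma resolution_ext (V : zmodType) (f g : {additive resolution -> V}) :
  (forall s, f (simplex s) = g (simplex s)) -> f =1 g.
Proof. exact: zlift_ext. Qed.

Section Lift.
Context (M : gmodType G) (f : n.+1.-tuple G -> M).
Hypothesis fG : forall u s, f (tuple_act u s) = gact u (f s).

Lemma chain_lift_subproof : (zlift f : resolution -> M) \in @homG_pred G _ M.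
Proof.
apply/asboolP; split=> [x y|u x]; first by rewrite raddfB.
apply: (@resolution_ext _ (zlift f \o ract u) (gact u \o zlift f)) => s /=.
by rewrite ract_simplex !zliftU fG.
Qed.

(* The homogeneous cochain determined by its (equivariant) values on tuples. *)
Definition chain_lift : homG resolution M := HomG chain_lift_subproof.

Lemma chain_liftE s : chain_lift (simplex s) = f s.
Proof. exact: zliftU. Qed.

End Lift.
End Resolution.

Section Vertices.
Context (G : groupType).

(* Out of range, [inord] falls back to a vertex of s: this keeps [vertex]     *)
(* equivariant for all k.                                                     *)
Definition vertex n (s : n.+1.-tuple G) (k : nat) : G := tnth s (inord k).

Definition subsimplex n m (f : nat -> nat) (s : n.+1.-tuple G) :
    m.+1.-tuple G :=
  [tuple vertex s (f j) | j < m.+1].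

Lemma vertex_act n u (s : n.+1.-tuple G) k :
  vertex (tuple_act u s) k = (u * vertex s k)%g.
Proof. by rewrite /vertex tnth_map. Qed.

Lemma subsimplex_act n m f u (s : n.+1.-tuple G) :
  subsimplex m f (tuple_act u s) = tuple_act u (subsimplex m f s).
Proof. by apply: eq_from_tnth => j; rewrite !(tnth_mktuple, tnth_map) vertex_act. Qed.

End Vertices.

Section BoundaryAndCochains.
Context (G : groupType).

Definition boundary_fun n (s : n.+2.-tuple G) : resolution G n :=
  \sum_(i < n.+2) simplex (subsimplex n (bump i) s) *~ (-1) ^+ i.

Lemma boundary_fun_act n u (s : n.+2.-tuple G) :
  boundary_fun (tuple_act u s) = gact u (boundary_fun s).
Proof.
rewrite raddf_sum; apply: eq_bigr => i _.
by rewrite raddfMz /= gact_simplex subsimplex_act.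
Qed.

Definition boundary n : homG (resolution G n.+1) (resolution G n) :=
  chain_lift (@boundary_fun_act n).

Definition cochain (M : gmodType G) (n : nat) : zmodType :=
  homG (resolution G n) M.

Definition coboundary (M : gmodType G) n (a : cochain M n) : cochain M n.+1 :=
  homG_comp a (boundary n).

Lemma coboundaryE (M : gmodType G) n (a : cochain M n) (s : n.+2.-tuple G) :
  coboundary a (simplex s) =
  \sum_(i < n.+2) a (simplex (subsimplex n (bump i) s)) *~ (-1) ^+ i.
Proof.
rewrite -[LHS]/(a (boundary n (simplex s))).
rewrite [boundary n _](chain_liftE (@boundary_fun_act n)) raddf_sum.
by apply: eq_bigr => i _; rewrite raddfMz.
Qed.

Lemma coboundary_is_zmod_morphism M n : zmod_morphism (@coboundary M n).
Proof. by move=> a b; apply: val_inj. Qed.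

HB.instance Definition _ M n :=
  GRing.isZmodMorphism.Build (cochain M n) (cochain M n.+1) (@coboundary M n)
    (@coboundary_is_zmod_morphism M n).

Definition pushforward (M N : gmodType G) n (f : homG M N) (c : cochain M n) :
  cochain N n := homG_comp f c.

Definition swap (N M : gmodType G) : tensor N M -> tensor M N :=
  tlift (fun n m => tens m n).

Lemma swap_biadditive (N M : gmodType G) :
  biadditive (fun (n : N) (m : M) => tens m n).
Proof. by split=> ? ? ?; rewrite (tensDl, tensDr). Qed.

HB.instance Definition _ (N M : gmodType G) :=
  GRing.isZmodMorphism.Build (tensor N M) (tensor M N) (@swap N M)
    (tlift_is_zmod_morphism (swap_biadditive N M)).

Lemma swap_tens (N M : gmodType G) (n : N) (m : M) :
  swap (tens n m) = tens m n.
Proof. exact: tlift_tens (swap_biadditive N M). Qed.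

Lemma swap_subproof (N M : gmodType G) : @swap N M \in @homG_pred G _ _.
Proof.
apply/asboolP; split=> [x y|u x]; first by rewrite raddfB.
apply: (@tensor_ext _ _ _ (@swap N M \o gact u) (gact u \o @swap N M)) => n m.
by rewrite /= gact_tens !swap_tens gact_tens.
Qed.

Definition swapG (N M : gmodType G) : homG (tensor N M) (tensor M N) :=
  HomG (swap_subproof N M).

Section Products.
Context (M N : gmodType G) (p q : nat) (a : cochain M p) (b : cochain N q).

Lemma cochain_subsimplex_act (P : gmodType G) n m (c : cochain P m) f u
    (s : n.+1.-tuple G) :
  c (simplex (subsimplex m f (tuple_act u s))) =
  gact u (c (simplex (subsimplex m f s))).
Proof. by rewrite subsimplex_act -gact_simplex homG_gact. Qed.

Definition cup_fun (s : (p + q).+1.-tuple G) : tensor M N :=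
  tens (a (simplex (subsimplex p id s)))
       (b (simplex (subsimplex q (addn p) s))).

Lemma cup_fun_act u s : cup_fun (tuple_act u s) = gact u (cup_fun s).
Proof. by rewrite gact_tens /cup_fun !cochain_subsimplex_act. Qed.

Definition cup : cochain (tensor M N) (p + q) := chain_lift cup_fun_act.

(* The i-th summand evaluates a at (s_0, ..., s_i, s_(i+q), ..., s_n) and     *)
(* b at (s_i, ..., s_(i+q)), where n = p + q - 1; it is meaningful only for   *)
(* p, q > 0.                                                                  *)
Definition prism_fun (s : (p + q).-1.+1.-tuple G) : tensor M N :=
  (\sum_(i < p)
     tens (a (simplex (subsimplex p
                (fun j => if j <= i then j else j + q - 1)%N s)))
          (b (simplex (subsimplex q (addn i) s)))
       *~ (-1) ^+ (q.+1 * i)) *~ (-1) ^+ (p * q + q).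

Lemma prism_fun_act u s : prism_fun (tuple_act u s) = gact u (prism_fun s).
Proof.
rewrite raddfMz raddf_sum; congr (_ *~ _); apply: eq_bigr => i _.
by rewrite raddfMz /= gact_tens !cochain_subsimplex_act.
Qed.

Definition prism : cochain (tensor M N) (p + q).-1 := chain_lift prism_fun_act.

End Products.
End BoundaryAndCochains.

Definition graded_family (V : nat -> zmodType) : Type := forall n, V n.

HB.instance Definition _ (V : nat -> zmodType) :=
  Choice.copy (graded_family V) (forall n, V n).

Section GradedFamily.
Context (V : nat -> zmodType).
Implicit Types x y z : graded_family V.

Definition gf_zero : graded_family V := fun=> 0.
Definition gf_add x y : graded_family V := fun n => x n + y n.
Definition gf_opp x : graded_family V := fun n => - x n.

Lemma gf_addA : associative gf_add.
Proof. by move=> x y z; apply: functional_extensionality_dep => n; apply: addrA. Qed.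
Lemma gf_addC : commutative gf_add.
Proof. by move=> x y; apply: functional_extensionality_dep => n; apply: addrC. Qed.
Lemma gf_add0 : left_id gf_zero gf_add.
Proof. by move=> x; apply: functional_extensionality_dep => n; apply: add0r. Qed.
Lemma gf_addN : left_inverse gf_zero gf_opp gf_add.
Proof. by move=> x; apply: functional_extensionality_dep => n; apply: addNr. Qed.

HB.instance Definition _ :=
  GRing.isZmodule.Build (graded_family V) gf_addA gf_addC gf_add0 gf_addN.

Definition finite_support : {pred graded_family V} :=
  fun x => `[< exists m, forall n, (m <= n)%N -> x n = 0 >].

Lemma finite_support_closed : zmod_closed finite_support.
Proof.
split; first by apply/asboolP; exists 0%N.
move=> x y /asboolP[m xm] /asboolP[k yk]; apply/asboolP; exists (maxn m k) => n.
rewrite geq_max => /andP[mn kn].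
by rewrite -[LHS]/(x n - y n) xm // yk // subrr.
Qed.

HB.instance Definition _ :=
  GRing.isZmodClosed.Build (graded_family V) finite_support
    finite_support_closed.

(* The direct sum of the V n. *)
Record dsum := Dsum {
  dsum_val : graded_family V;
  _ : dsum_val \in finite_support
}.

HB.instance Definition _ := [isSub for dsum_val].
HB.instance Definition _ := [Choice of dsum by <:].
HB.instance Definition _ := [SubChoice_isSubZmodule of dsum by <:].

Definition component (x : dsum) (n : nat) : V n := dsum_val x n.
Coercion component : dsum >-> Funclass.

Lemma dsumP (x y : dsum) : (forall n, x n = y n) -> x = y.
Proof. by move=> xy; apply: val_inj; apply: functional_extensionality_dep. Qed.

Lemma componentB (x y : dsum) n : (x - y) n = x n - y n.
Proof. by []. Qed.

Lemma dsum_support (x : dsum) : exists m, forall n, (m <= n)%N -> x n = 0.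
Proof. by case: x => x /= /asboolP. Qed.

Lemma incl_subproof n (x : V n) :
  dfwith (fun m => 0 : V m) x \in finite_support.
Proof.
apply/asboolP; exists n.+1 => m nm; rewrite dfwith_out //.
by rewrite neq_ltn nm.
Qed.

Definition incl n (x : V n) : dsum := Dsum (incl_subproof x).

Lemma incl_is_zmod_morphism n : zmod_morphism (@incl n).
Proof.
move=> x y; apply: dsumP => m; rewrite componentB /component /=.
have [<-|nm] := eqVneq n m; first by rewrite !dfwith_in.
by rewrite !dfwith_out // subr0.
Qed.

HB.instance Definition _ n :=
  GRing.isZmodMorphism.Build (V n) dsum (@incl n) (@incl_is_zmod_morphism n).

End GradedFamily.

Section TotalComplex.
Context (V : nat -> zmodType) (d : forall n, {additive V n -> V n.+1}).

Definition dsum_diff_fun (x : graded_family V) : graded_family V :=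
  fun n => if n is m.+1 then d m (x m) else 0.

Lemma dsum_diff_subproof (x : dsum V) :
  dsum_diff_fun (dsum_val x) \in @finite_support V.
Proof.
have [m xm] := dsum_support x; apply/asboolP; exists m.+1 => -[//|n] mn /=.
by rewrite -[dsum_val x n]/(x n) xm // raddf0.
Qed.

Definition dsum_diff (x : dsum V) : dsum V := Dsum (dsum_diff_subproof x).

Lemma dsum_diff_is_zmod_morphism : zmod_morphism dsum_diff.
Proof.
by move=> x y; apply: dsumP => -[|n] /=; [rewrite -[RHS]/(0 - 0) subr0 | exact: raddfB].
Qed.

HB.instance Definition _ :=
  GRing.isZmodMorphism.Build (dsum V) (dsum V) dsum_diff
    dsum_diff_is_zmod_morphism.

Lemma dsum_diff_incl n (x : V n) : dsum_diff (incl x) = incl (d n x).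
Proof.
apply: dsumP => -[|m]; rewrite /component /=; first by rewrite dfwith_out.
have [<-|nm] := eqVneq n m; first by rewrite !dfwith_in.
by rewrite !dfwith_out // raddf0.
Qed.

End TotalComplex.

Section DegreeSign.
Context (V : nat -> zmodType).

Lemma dsum_sign_subproof (x : dsum V) :
  ((fun n => x n *~ (-1) ^+ n) : graded_family V) \in @finite_support V.
Proof.
have [m xm] := dsum_support x; apply/asboolP; exists m => n mn.
by rewrite xm // mul0rz.
Qed.

Definition dsum_sign (x : dsum V) : dsum V := Dsum (dsum_sign_subproof x).

Lemma dsum_sign_is_zmod_morphism : zmod_morphism dsum_sign.
Proof. by move=> x y; apply: dsumP => n; exact: mulrzBl. Qed.

HB.instance Definition _ :=
  GRing.isZmodMorphism.Build (dsum V) (dsum V) dsum_sign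
    dsum_sign_is_zmod_morphism.

Lemma dsum_sign_incl n (x : V n) : dsum_sign (incl x) = incl x *~ (-1) ^+ n.
Proof.
rewrite -raddfMz; apply: dsumP => m; rewrite /component /= /component /=.
have [<-|nm] := eqVneq n m; first by rewrite !dfwith_in.
by rewrite !dfwith_out // mul0rz.
Qed.

End DegreeSign.

Section TensorComplex.
Context (V W : nat -> zmodType).
Context (dV : forall n, {additive V n -> V n.+1}).
Context (dW : forall n, {additive W n -> W n.+1}).

Definition tensor_diff : tensor (dsum V) (dsum W) -> tensor (dsum V) (dsum W) :=
  tmap (dsum_diff dV) idfun \+ tmap (@dsum_sign V) (dsum_diff dW).

HB.instance Definition _ := GRing.Additive.on tensor_diff.

Lemma tensor_diff_incl p q (x : V p) (y : W q) :
  tensor_diff (tens (incl x) (incl y)) =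
  tens (incl (dV p x)) (incl y) + tens (incl x) (incl (dW q y)) *~ (-1) ^+ p.
Proof.
rewrite /tensor_diff /= !tmap_tens /= !dsum_diff_incl dsum_sign_incl.
by congr (_ + _); apply: (raddfMz (tensr (incl (dW q y)))).
Qed.

End TensorComplex.

Section CochainComplex.
Context (G : groupType).

(* Graded groups are represented by their total direct sums, so that the      *)
(* tensor product of complexes is the tensor product of the total groups and  *)
(* no transport along equalities of degrees such as q + p = p + q is needed.  *)
(* In particular, C^(-1) = 0 since there is no component of degree -1, and a  *)
(* map to the shift C[-1] is a map to C that lowers degrees by one.           *)
Definition cochains (M : gmodType G) : zmodType := dsum (cochain M).

Definition diff (M : gmodType G) : cochains M -> cochains M :=
  @dsum_diff (cochain M) (fun n => @coboundary G M n).

Definition diff2 (M N : gmodType G) :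
    tensor (cochains M) (cochains N) -> tensor (cochains M) (cochains N) :=
  @tensor_diff (cochain M) (cochain N)
    (fun n => @coboundary G M n) (fun n => @coboundary G N n).

Definition is_homotopy (M N : gmodType G)
    (h : {additive tensor (cochains M) (cochains N) ->
            cochains (tensor M N)}) : Prop :=
  forall p q (a : cochain M p) (b : cochain N q),
    (p = 0%N \/ q = 0%N -> h (tens (incl a) (incl b)) = 0) /\
    ((0 < p)%N -> (0 < q)%N -> h (tens (incl a) (incl b)) = incl (prism a b)).

End CochainComplex.

Section Inhomogeneous.
Context (G : groupType).

Section Correspondence.
Context (M : gmodType G) (n : nat).

Definition homogeneous_fun (a : n.-tuple G -> M) (t : n.+1.-tuple G) : M :=
  gact (vertex t 0)
    (a [tuple ((vertex t i)^-1 * vertex t i.+1)%g | i < n]).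

Lemma homogeneous_fun_act a u t :
  homogeneous_fun a (tuple_act u t) = gact u (homogeneous_fun a t).
Proof.
rewrite /homogeneous_fun vertex_act gactM; congr (gact _ (gact _ (a _))).
apply: eq_from_tnth => i; rewrite !tnth_mktuple !vertex_act.
by rewrite invgM -mulgA mulKg.
Qed.

Definition homogeneous (a : n.-tuple G -> M) : cochain M n :=
  chain_lift (homogeneous_fun_act a).

Definition inhomogeneous (c : cochain M n) (s : n.-tuple G) : M :=
  c (simplex [tuple \big[*%g/1%g]_(0 <= k < i) nth 1%g s k | i < n.+1]).

Lemma vertexE m (f : nat -> G) k : (k <= m)%N ->
  vertex [tuple f i | i < m.+1] k = f k.
Proof. by move=> km; rewrite /vertex tnth_mktuple inordK. Qed.

Lemma homogeneousK : cancel homogeneous inhomogeneous.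
Proof.
move=> a; apply: functional_extensionality_dep => s.
rewrite /inhomogeneous [LHS]chain_liftE /homogeneous_fun.
rewrite (vertexE (fun i => \big[*%g/1%g]_(0 <= k < i) nth 1%g s k)) //.
rewrite big_nil gact1; congr (a _); apply: eq_from_tnth => i.
rewrite tnth_mktuple.
rewrite !(vertexE (fun i => \big[*%g/1%g]_(0 <= k < i) nth 1%g s k)) //;
  last exact: ltnW.
by rewrite big_nat_recr //= mulKg (tnth_nth 1%g).
Qed.

Lemma inhomogeneousK : cancel inhomogeneous homogeneous.
Proof.
move=> c; apply: val_inj; apply: functional_extensionality_dep.
apply: (@resolution_ext _ _ _ (homogeneous (inhomogeneous c)) c) => t.
rewrite [LHS]chain_liftE /homogeneous_fun /inhomogeneous -homG_gact.
rewrite gact_simplex; congr (c (simplex _)); apply: eq_from_tnth => i.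
rewrite tnth_map tnth_mktuple.
have -> : tnth t i = vertex t i by rewrite /vertex inord_val.
elim: (i : nat) (leq_ord i) => [_|k IHk kn]; first by rewrite big_nil mulg1.
rewrite big_nat_recr //= mulgA IHk ?(ltnW kn) //.
by rewrite (nth_mktuple _ _ (Ordinal kn)) mulVKg.
Qed.

End Correspondence.

Context (M N : gmodType G) (p q : nat).

(* With 0-based indices s_0, ..., s_(p+q-2), the i-th summand evaluates a at  *)
(* (s_0, ..., s_(i-1), s_i ... s_(i+q-1), s_(i+q), ..., s_(p+q-2)) and        *)
(* s_0 ... s_(i-1) b at (s_i, ..., s_(i+q-1)).                                *)
Definition inhomogeneous_prism (a : p.-tuple G -> M) (b : q.-tuple G -> N)
    (s : (p + q).-1.-tuple G) : tensor M N :=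
  let s_ := nth 1%g s in
  (\sum_(i < p)
     tens (a [tuple if (j < i)%N then s_ j
                    else if j == i then \big[*%g/1%g]_(i <= k < i + q) s_ k
                    else s_ (j + q - 1)%N | j < p])
          (gact (\big[*%g/1%g]_(0 <= k < i) s_ k)
                (b [tuple s_ (i + j)%N | j < q]))
       *~ (-1) ^+ (q.+1 * i)) *~ (-1) ^+ (p * q + q).

End Inhomogeneous.

(* Main.v *)
Require Import Defs.
From HB Require Import structures.
From mathcomp Require Import all_boot all_algebra.
From mathcomp Require Import boolp zify.

Set Implicit Arguments.
Unset Strict Implicit.
Unset Printing Implicit Defensive.

Import GRing.Theory.
Local Open Scope ring_scope.

(* Evaluate cochains at vertex sequences s : nat -> G, so that every term is  *)
(* of the form phi f g = a (s o f) (x) b (s o g).  Up to signs, the terms of  *)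
(* dh(a (x) b) that delete s_i, an earlier vertex, or a vertex after s_(i+q)  *)
(* cancel against h(da (x) b), and those that delete one of                   *)
(* s_(i+1), ..., s_(i+q) cancel against h(a (x) db).  The remaining terms,    *)
(* which pair a (..., s_(i-1), s_(i+q), ...) or a (..., s_i, s_(i+q+1), ...)  *)
(* with b (s_i, ..., s_(i+q)), telescope over i, from t_*(b u a) to a u b.    *)
(* For q = 0 the formula is a telescoping sum by itself.                      *)

(** Up to sign, h is Steenrod's cup-1 product, and the formula of part (i) is its coboundary
    formula. The map exists because biadditive maps on all C^p x C^q extend to the tensor product of
    the direct sums ([dlift], then [tlift]); it is unique because homogeneous pure tensors generate
    that group ([tensor_dsum_ext]).

    For q > 0, evaluation at a vertex sequence reduces the formula to [prism_identity], which
    concerns only the indices given to a and b: [collapse q i] lists those given to a, with the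
    block i, ..., i+q contracted to an edge. The case p = 0 is included, with empty sums. The case q
    = 0 is [prism_homotopy0].

    Part (ii) is a change of coordinates, [prism_homogeneous]: a product of successive quotients of
    vertices telescopes to the quotient along the contracted edge. *)

Section Signs.
Context (V : zmodType).
Implicit Types x : V.

Lemma mulrz_sign x k : x *~ (-1) ^+ k = if odd k then - x else x.
Proof. by rewrite -signr_odd; case: (odd k); rewrite ?mulrN1z. Qed.

Lemma mulrz_sign_eq x k l :
  odd k = odd l -> x *~ (-1) ^+ k = x *~ (-1) ^+ l.
Proof. by rewrite !mulrz_sign => ->. Qed.

Lemma mulrz_sign_opp x k l :
  odd k = ~~ odd l -> x *~ (-1) ^+ k = - (x *~ (-1) ^+ l).
Proof. by rewrite !mulrz_sign => ->; case: (odd l); rewrite ?opprK. Qed.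

Lemma mulrz_signD x k l : x *~ (-1) ^+ k *~ (-1) ^+ l = x *~ (-1) ^+ (k + l).
Proof. by rewrite -mulrzA exprD. Qed.

End Signs.

(** * Additive maps out of direct sums *)

Section DirectSums.
Context (V : nat -> zmodType).

Lemma incl_in n (x : V n) : incl x n = x.
Proof. exact: dfwith_in. Qed.

Lemma incl_out n m (x : V n) : n != m -> incl x m = 0.
Proof. exact: dfwith_out. Qed.

Lemma dsum_bound (x : dsum V) : {m | forall n, (m <= n)%N -> x n = 0}.
Proof. exact: cid (dsum_support x). Qed.

(** The universal map out of the direct sum. A support bound is chosen so that the sum is finite;
    for additive [f], [dlift_widen] shows that the choice does not matter. *)
Definition dlift (W : zmodType) (f : forall n, V n -> W) (x : dsum V) : W :=
  \sum_(n < sval (dsum_bound x)) f n (x n).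

(** All three sums use the same chosen bound of [x], so they add termwise. This gives additivity of
    a pairing in the variable on which the family depends. *)
Lemma dlift_add (W : zmodType) (f g k : forall n, V n -> W) (x : dsum V) :
  (forall n v, @k n v = @f n v + @g n v) -> dlift k x = dlift f x + dlift g x.
Proof. by move=> kE; rewrite /dlift -big_split; apply: eq_bigr => n _. Qed.

Section Lift.
Context (W : zmodType) (f : forall n, V n -> W).
Hypothesis fD : forall n, {morph @f n : x y / x + y}.

Let f0 n : @f n 0 = 0.
Proof. by apply: (addrI (@f n 0)); rewrite -fD !addr0. Qed.

Lemma dlift_widen (x : dsum V) m :
  (forall n, (m <= n)%N -> x n = 0) -> dlift f x = \sum_(n < m) f (x n).
Proof.
(* Two bounds k and m are compared through the common bound k + m. *)
have widen k l : (forall n, (k <= n)%N -> x n = 0) ->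
    \sum_(n < k + l) f (x n) = \sum_(n < k) f (x n).
  move=> xk; rewrite big_split_ord /= [X in _ + X]big1 ?addr0 // => i _.
  by rewrite xk ?leq_addr.
move=> xm; rewrite /dlift; case: (dsum_bound x) => k xk /=.
by rewrite -(widen k m) // addnC widen.
Qed.

Lemma dliftD : {morph dlift f : x y / x + y}.
Proof.
move=> x y; have [k xk] := dsum_support x; have [l yl] := dsum_support y.
have ple n : (k + l <= n)%N -> x n = 0 /\ y n = 0.
  by move=> kn; split; [apply: xk | apply: yl]; lia.
rewrite (@dlift_widen x (k + l)) => [|n /ple[]//].
rewrite (@dlift_widen y (k + l)) => [|n /ple[]//].
rewrite (@dlift_widen _ (k + l)) => [|n /ple[x0 y0]].
  by rewrite -big_split; apply: eq_bigr => i _; exact: fD.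
by rewrite -[LHS]/(x n + y n) x0 y0 addr0.
Qed.

Lemma dlift_incl n (x : V n) : dlift f (incl x) = f x.
Proof.
rewrite (@dlift_widen _ n.+1) => [|m nm]; last by rewrite incl_out ?ltn_eqF.
rewrite big_ord_recr big1 => [|i _].
  exact: etrans (add0r _) (congr1 (@f n) (incl_in x)).
by rewrite incl_out ?f0 // gtn_eqF /=.
Qed.

End Lift.

Lemma dsum_sum_incl (x : dsum V) m :
  (forall n, (m <= n)%N -> x n = 0) -> x = \sum_(n < m) incl (x n).
Proof.
move=> xm; apply: dsumP => k.
have cD : {morph (fun z : dsum V => z k) : x y / x + y} by [].
have c0 : (0 : dsum V) k = 0 by [].
rewrite (big_morph (fun z : dsum V => z k) cD c0).
have [km|mk] := ltnP k m.
  rewrite (bigD1 (Ordinal km)) // big1 => [|i ik].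
    exact: etrans (esym (incl_in (x k))) (esym (addr0 _)).
  exact: incl_out.
rewrite xm // big1 // => i _; rewrite incl_out //.
by rewrite ltn_eqF // (leq_trans (ltn_ord i)).
Qed.

Lemma dsum_ext (W : zmodType) (f g : {additive dsum V -> W}) :
  (forall n (x : V n), f (incl x) = g (incl x)) -> f =1 g.
Proof.
move=> fg x; have [m xm] := dsum_support x.
by rewrite (dsum_sum_incl xm) !raddf_sum; apply: eq_bigr => i _.
Qed.

End DirectSums.

Lemma tensor_dsum_ext (V W : nat -> zmodType) (X : zmodType)
    (f g : {additive tensor (dsum V) (dsum W) -> X}) :
  (forall p q (x : V p) (y : W q),
     f (tens (incl x) (incl y)) = g (tens (incl x) (incl y))) -> f =1 g.
Proof.
move=> fg; apply: tensor_ext => x y.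
apply: (@dsum_ext _ _ (f \o tens x) (g \o tens x)) => q v /=.
apply: (@dsum_ext _ _ (f \o tensr (incl v)) (g \o tensr (incl v))) => p u /=.
exact: fg.
Qed.

(** * The cancellation between faces of the prism *)

Definition collapse (q i j : nat) : nat :=
  if (j <= i)%N then j else (j + q - 1)%N.

Section PrismIdentity.
Context (V : zmodType) (p q : nat) (phi : (nat -> nat) -> (nat -> nat) -> V).
Hypothesis q_gt0 : (0 < q)%N.
Hypothesis phi_eq : forall f f' g g',
  (forall k, (k <= p)%N -> f k = f' k) ->
  (forall k, (k <= q)%N -> g k = g' k) -> phi f g = phi f' g'.

(* With phi f g = a (s o f) (x) b (s o g), these are the i-th summands of     *)
(* h(da (x) b), (-1)^p h(a (x) db) and dh(a (x) b), multiplied by (-1)^(pq).  *)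
Let row1 i := \sum_(j < p.+2)
  phi (collapse q i \o bump j) (addn i) *~ (-1) ^+ (q.+1 * i + j).
Let row2 i := \sum_(j < q.+2)
  phi (collapse q.+1 i) (addn i \o bump j) *~ (-1) ^+ (q.+1 + q * i + j).
Let row3 i := \sum_(j < (p + q).+1)
  phi (bump j \o collapse q i) (bump j \o addn i) *~ (-1) ^+ (q + q.+1 * i + j).

(** [head] and [tail] delete from a a vertex before or after the block i, ..., i+q given to b; [mid]
    deletes an interior vertex of a block of b that is longer by one. In [left] and [right], a lacks
    the first or the last q vertices of the block: they come from deleting an end of the block. *)
Let head i := \sum_(0 <= j < i)
  phi (collapse q i \o bump j) (addn i) *~ (-1) ^+ (q.+1 * i + j).
Let tail i := \sum_(i.+2 <= j < p.+2)
  phi (collapse q i \o bump j) (addn i) *~ (-1) ^+ (q.+1 * i + j).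
Let mid i := \sum_(1 <= j < q.+1)
  phi (collapse q.+1 i) (addn i \o bump j) *~ (-1) ^+ (q.+1 + q * i + j).
Let omit i j := if (j < i)%N then j else (j + q)%N.
Let left i := phi (omit i) (addn i) *~ (-1) ^+ (q * i).
Let right i := phi (omit i.+1) (addn i) *~ (-1) ^+ (q * i).

Let row1E i : (i <= p)%N -> row1 i = head i + left i - right i + tail i.
Proof.
move=> ip; rewrite /row1 -(big_mkord xpredT (fun j =>
  phi (collapse q i \o bump j) (addn i) *~ (-1) ^+ (q.+1 * i + j))).
rewrite (@big_cat_nat _ _ _ i) //=; last lia.
rewrite (@big_ltn _ _ _ i); last lia.
rewrite (@big_ltn _ _ _ i.+1); last lia.
rewrite !addrA; congr (_ + _ + _ + _).
  rewrite /left (@mulrz_sign_eq _ _ _ (q * i)); last first.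
    by rewrite !(oddD, oddM) /=; case: (odd i); case: (odd q).
  congr (_ *~ _); apply: phi_eq => // k _;
    rewrite /= /collapse /omit /bump; do ?case: ifP => ?; lia.
rewrite /right (@mulrz_sign_opp _ _ _ (q * i)); last first.
  by rewrite !(oddD, oddM) /=; case: (odd i); case: (odd q).
congr (- (_ *~ _)); apply: phi_eq => // k _;
  rewrite /= /collapse /omit /bump; do ?case: ifP => ?; lia.
Qed.

(** Deleting the first vertex of the longer block of b moves the block to i+1, hence [left i.+1];
    deleting the last one leaves the block at i, hence [right i]. *)
Let row2E i : row2 i = - left i.+1 + mid i + right i.
Proof.
rewrite /row2 -(big_mkord xpredT (fun j =>
  phi (collapse q.+1 i) (addn i \o bump j) *~ (-1) ^+ (q.+1 + q * i + j))).
rewrite big_ltn // big_nat_recr //= addrA.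
congr (_ + _ + _).
  rewrite /left (@mulrz_sign_opp _ _ _ (q * i.+1)); last first.
    by rewrite !(oddD, oddM) /=; case: (odd i); case: (odd q).
  by congr (- (_ *~ _)); apply: phi_eq => k kq;
    rewrite /= /collapse /omit /bump; do ?case: ifP => ?; lia.
rewrite /right (@mulrz_sign_eq _ _ _ (q * i)); last first.
  by rewrite !(oddD, oddM) /=; case: (odd i); case: (odd q).
by congr (_ *~ _); apply: phi_eq => k kq;
  rewrite /= /collapse /omit /bump; do ?case: ifP => ?; lia.
Qed.

(** Deleting s_j with j <= i pushes the block one place to the right, hence [head i.+1]. A deletion
    among i+1, ..., i+q falls inside the longer block of b, and a later one leaves the block at
    i. *)
Let row3E i : (i < p)%N -> row3 i = - head i.+1 - mid i - tail i.
Proof.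
move=> ip; rewrite /row3 -(big_mkord xpredT (fun j =>
  phi (bump j \o collapse q i) (bump j \o addn i)
    *~ (-1) ^+ (q + q.+1 * i + j))).
rewrite (@big_cat_nat _ _ _ i.+1) //=; last lia.
rewrite (@big_cat_nat _ _ _ (i + q).+1 i.+1) //=; [|lia..].
rewrite addrA /head /mid /tail -!sumrN; congr (_ + _ + _).
- apply: eq_big_nat => j ji.
  rewrite (@mulrz_sign_opp _ _ _ (q.+1 * i.+1 + j)); last first.
    by rewrite !(oddD, oddM) /=; case: (odd i); case: (odd q); case: (odd j).
  by congr (- (_ *~ _)); apply: phi_eq => k kq;
    rewrite /= /collapse /bump; do ?case: ifP => ?; lia.
- rewrite -(add1n i) -(addnS i) (addnC i q.+1) big_addn addnK.
  apply: eq_big_nat => j ji.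
  rewrite (@mulrz_sign_opp _ _ _ (q.+1 + q * i + j)); last first.
    by rewrite !(oddD, oddM) /=; case: (odd i); case: (odd q); case: (odd j).
  by congr (- (_ *~ _)); apply: phi_eq => k kq;
    rewrite /= /collapse /bump; do ?case: ifP => ?; lia.
(* The list given to a lacks the q - 1 interior vertices of the block, so positions after the block
   shift by q - 1. *)
rewrite (_ : (i + q).+1 = i.+2 + q.-1)%N; last lia.
rewrite (_ : (p + q).+1 = p.+2 + q.-1)%N; last lia.
rewrite big_addn addnK; apply: eq_big_nat => j ji.
(* Writing q as a successor exposes the parity of the shift q - 1. *)
have -> : q = q.-1.+1 by lia.
rewrite (@mulrz_sign_opp _ _ _ (q.-1.+2 * i + j)); last first.
  by rewrite !(oddD, oddM) /=; case: (odd i); case: (odd q.-1); case: (odd j).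
by congr (- (_ *~ _)); apply: phi_eq => k kq;
  rewrite /= /collapse /bump; do ?case: ifP => ?; lia.
Qed.

(** For each i < p the three rows add up to g i - g (i+1), where g is [head] plus [left]. The extra
    row i = p contributes g p - [right p], so only [left 0] and [right p] survive: the two cup
    products. *)
Lemma prism_identity :
  \sum_(i < p.+1) row1 i + \sum_(i < p) row2 i + \sum_(i < p) row3 i =
  phi (addn q) id - phi id (addn p) *~ (-1) ^+ (p * q).
Proof.
pose g i := head i + left i.
have step i : (i < p)%N -> row1 i + row2 i + row3 i = - (g i.+1 - g i).
  move=> ip; rewrite row1E 1?ltnW // row2E row3E // opprB opprD.
  (* Leaf 1 is [g i], leaves 7 and 4 form [- g i.+1]; the pairs 2-6, 3-9 and 5-8 cancel [right],
     [tail] and [mid]. *)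
  rewrite [LHS](AC (3*3*3) (1*(7*4)*(2*6)*(3*9)*(5*8))) /=.
  by rewrite addNr !subrr !addr0.
have tail_p : tail p = 0 by rewrite /tail big_geq.
have head0 : head 0 = 0 by rewrite /head big_geq.
rewrite big_ord_recr /= row1E // tail_p addr0.
set last := _ + _ - _; rewrite !(addrAC _ last) -!big_split /= {}/last.
rewrite (eq_bigr (fun i : 'I_p => - (g i.+1 - g i))) => [|i _]; last first.
  exact: step.
rewrite sumrN -(big_mkord xpredT (fun i => g i.+1 - g i)) telescope_sumr //.
rewrite opprB /g head0 add0r addrA subrK.
rewrite (mulnC p) /right; congr (_ - _ *~ _).
  by rewrite /left muln0 mulr1z; apply: phi_eq => k _ //=; rewrite /omit addnC.
by apply: phi_eq => k //= kp; rewrite /omit ltnS kp.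
Qed.

End PrismIdentity.

(** * Evaluation of cochains and construction of the homotopy *)

Section Evaluation.
Context (G : groupType).

(* Only s 0, ..., s n matter; with s total, faces are precompositions.        *)
Definition coeval (M : gmodType G) n (s : nat -> G) (c : cochain M n) : M :=
  c (simplex [tuple s i | i < n.+1]).

Section Module.
Context (M : gmodType G).

Lemma coeval_is_zmod_morphism n s : zmod_morphism (@coeval M n s).
Proof. by []. Qed.

HB.instance Definition _ n s :=
  GRing.isZmodMorphism.Build (cochain M n) M (@coeval M n s)
    (@coeval_is_zmod_morphism n s).

Lemma coevalB n s (c d : cochain M n) :
  coeval s (c - d) = coeval s c - coeval s d.
Proof. by []. Qed.

Lemma coevalD n s (c d : cochain M n) :
  coeval s (c + d) = coeval s c + coeval s d.
Proof. by []. Qed.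

Lemma coevalMz n s (c : cochain M n) k : coeval s (c *~ k) = coeval s c *~ k.
Proof. exact: raddfMz. Qed.

Lemma coeval_eq n (c : cochain M n) (s t : nat -> G) :
  (forall k, (k <= n)%N -> s k = t k) -> coeval s c = coeval t c.
Proof.
move=> st; congr (c (simplex _)); apply: eq_from_tnth => i.
by rewrite !tnth_mktuple st // leq_ord.
Qed.

Lemma cochain_ext n (c d : cochain M n) :
  (forall s, coeval s c = coeval s d) -> c = d.
Proof.
move=> cd; apply: val_inj; apply: functional_extensionality_dep.
apply: resolution_ext => t.
have -> : t = [tuple nth 1%g t i | i < n.+1]; last exact: cd.
by apply: eq_from_tnth => i; rewrite tnth_mktuple (tnth_nth 1%g).
Qed.

Lemma coeval_subsimplex n m f (c : cochain M m) (s : nat -> G) :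
  (forall j, (j <= m)%N -> (f j <= n)%N) ->
  c (simplex (subsimplex m f [tuple s i | i < n.+1])) = coeval (s \o f) c.
Proof.
move=> fn; congr (c (simplex _)); apply: eq_from_tnth => j.
by rewrite !tnth_mktuple vertexE // fn // leq_ord.
Qed.

Lemma coeval_coboundary n (c : cochain M n) s :
  coeval s (coboundary c) =
  \sum_(i < n.+2) coeval (s \o bump i) c *~ (-1) ^+ i.
Proof.
rewrite /coeval coboundaryE; apply: eq_bigr => i _.
by rewrite coeval_subsimplex // => j jn; rewrite /bump; lia.
Qed.

(* Replaces a transport of c along m = n. *)
Lemma incl_degree m n (c : cochain M m) : m = n ->
  exists2 c' : cochain M n, incl c = incl c' &
    forall s, coeval s c' = coeval s c.
Proof. by move=> <-; exists c. Qed.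

Lemma diff_incl n (c : cochain M n) : diff (incl c) = incl (coboundary c).
Proof. exact: dsum_diff_incl. Qed.

Lemma diff0 : diff (0 : cochains M) = 0.
Proof. exact: raddf0. Qed.

End Module.

Context (M N : gmodType G).

Lemma diff2_incl p q (a : cochain M p) (b : cochain N q) :
  diff2 (tens (incl a) (incl b)) =
  tens (incl (coboundary a)) (incl b)
    + tens (incl a) (incl (coboundary b)) *~ (-1) ^+ p.
Proof. exact: tensor_diff_incl. Qed.

Section Product.
Context (p q : nat).
Implicit Types (a : cochain M p) (b : cochain N q).

Lemma coeval_cup a b s :
  coeval s (cup a b) = tens (coeval s a) (coeval (s \o addn p) b).
Proof.
rewrite /coeval [LHS]chain_liftE /cup_fun !coeval_subsimplex //; lia.
Qed.

Lemma coeval_prism a b s : (0 < q)%N ->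
  coeval s (prism a b) =
  (\sum_(i < p) tens (coeval (s \o collapse q i) a) (coeval (s \o addn i) b)
     *~ (-1) ^+ (q.+1 * i)) *~ (-1) ^+ (p * q + q).
Proof.
move=> q_gt0; rewrite /coeval [LHS]chain_liftE; congr (_ *~ _).
apply: eq_bigr => i _; have ip := ltn_ord i; congr (tens _ _ *~ _).
  by apply: coeval_subsimplex => j jp; case: ifP => ?; lia.
by apply: coeval_subsimplex; lia.
Qed.

Lemma prism_biadditive : biadditive (@prism G M N p q).
Proof.
have evalE a b s : coeval s (prism a b) = prism_fun a b [tuple s i | i < _].
  exact: chain_liftE.
by split=> [b a a' | a b b']; apply: cochain_ext => s;
  rewrite coevalD !evalE /prism_fun -mulrzDl -big_split;
  congr (_ *~ _); apply: eq_bigr => i _;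
  rewrite -[RHS]mulrzDl -?(tensDl, tensDr).
Qed.

(** The test on q matters: for q = 0 the summands of [prism] repeat the vertex s_i in a and need not
    vanish, so the convention h = 0 has to be imposed. *)
Definition homotopy_bilinear a b : cochains (tensor M N) :=
  if (0 < p)%N && (0 < q)%N then incl (prism a b) else 0.

Lemma homotopy_bilinearDl b : {morph homotopy_bilinear^~ b : a a' / a + a'}.
Proof.
move=> a a'; rewrite /homotopy_bilinear; case: ifP => _; last by rewrite addr0.
by rewrite prism_biadditive.1 raddfD.
Qed.

Lemma homotopy_bilinearDr a : {morph homotopy_bilinear a : b b' / b + b'}.
Proof.
move=> b b'; rewrite /homotopy_bilinear; case: ifP => _; last by rewrite addr0.
by rewrite prism_biadditive.2 raddfD.
Qed.

End Product.

Definition homotopy_pairing (x : cochains M) (y : cochains N) :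
    cochains (tensor M N) :=
  dlift (fun p a => dlift (fun q b => homotopy_bilinear a b) y) x.

Lemma homotopy_pairing_biadditive : biadditive homotopy_pairing.
Proof.
split=> [y | x y y'].
  apply: dliftD => p a a'; apply: dlift_add => q b.
  exact: homotopy_bilinearDl.
by apply: dlift_add => p a; apply: dliftD => q; exact: homotopy_bilinearDr.
Qed.

Definition homotopy :
    tensor (cochains M) (cochains N) -> cochains (tensor M N) :=
  tlift homotopy_pairing.

HB.instance Definition _ :=
  GRing.isZmodMorphism.Build (tensor (cochains M) (cochains N))
    (cochains (tensor M N)) homotopy
    (tlift_is_zmod_morphism homotopy_pairing_biadditive).

Lemma homotopyE p q (a : cochain M p) (b : cochain N q) :
  homotopy (tens (incl a) (incl b)) = homotopy_bilinear a b.
Proof.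
rewrite /homotopy tlift_tens; last exact: homotopy_pairing_biadditive.
rewrite /homotopy_pairing dlift_incl => [|n c c'].
  by apply: dlift_incl => n; exact: homotopy_bilinearDr.
by apply: dlift_add => k d; exact: homotopy_bilinearDl.
Qed.

Lemma homotopyP : is_homotopy homotopy.
Proof.
move=> p q a b; split=> [pq0|p_gt0 q_gt0]; rewrite [LHS]homotopyE.
  by apply: ifN; case: pq0 => ->; rewrite ?andbF.
by rewrite /homotopy_bilinear p_gt0 q_gt0.
Qed.

Lemma is_homotopy_unique
    (h h' : {additive tensor (cochains M) (cochains N) ->
               cochains (tensor M N)}) :
  is_homotopy h -> is_homotopy h' -> h =1 h'.
Proof.
move=> hP h'P; apply: tensor_dsum_ext => p q a b.
have [h0 h1] := hP p q a b; have [h'0 h'1] := h'P p q a b.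
have [p0|p_gt0] := posnP p; first by rewrite h0 ?h'0; [|left..].
have [q0|q_gt0] := posnP q; first by rewrite h0 ?h'0; [|right..].
by rewrite h1 // h'1.
Qed.

End Evaluation.

(** * The homotopy formula *)

Section HomotopyFormula.
Context (G : groupType) (M N : gmodType G).

Lemma tens_suml (I : Type) (r : seq I) (F : I -> M) (y : N) :
  tens (\sum_(i <- r) F i) y = \sum_(i <- r) tens (F i) y.
Proof. exact: (raddf_sum (tensr y)). Qed.

Lemma tens_sumr (I : Type) (r : seq I) (x : M) (F : I -> N) :
  tens x (\sum_(i <- r) F i) = \sum_(i <- r) tens x (F i).
Proof. exact: raddf_sum. Qed.

Lemma tensMzl (x : M) (y : N) c : tens (x *~ c) y = tens x y *~ c.
Proof. exact: (raddfMz (tensr y)). Qed.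

Lemma tensMzr (x : M) (y : N) c : tens x (y *~ c) = tens x y *~ c.
Proof. exact: raddfMz. Qed.

Lemma coeval_swap_cup p q (a : cochain M p) (b : cochain N q) s :
  coeval s (pushforward (swapG N M) (cup b a)) =
  tens (coeval (s \o addn q) a) (coeval s b).
Proof.
by rewrite -[LHS]/(swap (coeval s (cup b a))) coeval_cup swap_tens.
Qed.

Lemma prism_homotopy p q (a : cochain M p) (b : cochain N q) : (0 < q)%N ->
  incl (pushforward (swapG N M) (cup b a)) *~ (-1) ^+ (p * q)
    - incl (cup a b) =
  incl (prism (coboundary a) b) + incl (prism a (coboundary b)) *~ (-1) ^+ p
    + incl (coboundary (prism a b)).
Proof.
move=> q_gt0.
(* The degrees of these terms equal p + q only propositionally; each cochain is replaced by one in
   degree p + q with the same values. *)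
have [c1 -> c1E] := incl_degree (pushforward (swapG N M) (cup b a)) (addnC q p).
have [c2 -> c2E] : exists2 c : cochain (tensor M N) (p + q),
    incl (prism a (coboundary b)) = incl c &
    forall s, coeval s c = coeval s (prism a (coboundary b)).
  by apply: incl_degree; lia.
have [c3 -> c3E] : exists2 c : cochain (tensor M N) (p + q),
    incl (coboundary (prism a b)) = incl c &
    forall s, coeval s c = coeval s (coboundary (prism a b)).
  by apply: incl_degree; lia.
rewrite -!raddfMz -!raddfB -!raddfD; congr incl; apply: cochain_ext => s.
rewrite coevalB !coevalD !coevalMz c1E c2E c3E.
pose phi f g := tens (coeval (s \o f) a) (coeval (s \o g) b).
have phi_eq f f' g g' : (forall k, (k <= p)%N -> f k = f' k) ->
    (forall k, (k <= q)%N -> g k = g' k) -> phi f g = phi f' g'.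
  by move=> ff' gg'; congr tens; apply: coeval_eq => k kn /=; rewrite ?ff' ?gg'.
(* Here and in the next two rewrites the common sign (-1)^(pq) is factored out, leaving the rows of
   [prism_identity]. *)
have -> : coeval s (prism (coboundary a) b) = (\sum_(i < p.+1) \sum_(j < p.+2)
    phi (collapse q i \o bump j) (addn i) *~ (-1) ^+ (q.+1 * i + j))
      *~ (-1) ^+ (p * q).
  rewrite coeval_prism // (@mulrz_sign_eq _ _ _ (p * q)); last first.
    by rewrite !(oddD, oddM) /=; case: (odd q); case: (odd p).
  congr (_ *~ _); apply: eq_bigr => i _.
  rewrite coeval_coboundary tens_suml mulrz_suml; apply: eq_bigr => j _.
  by rewrite tensMzl mulrz_signD addnC.
have -> : coeval s (prism a (coboundary b)) *~ (-1) ^+ p =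
    (\sum_(i < p) \sum_(j < q.+2)
      phi (collapse q.+1 i) (addn i \o bump j) *~ (-1) ^+ (q.+1 + q * i + j))
      *~ (-1) ^+ (p * q).
  rewrite coeval_prism // !mulrz_suml; apply: eq_bigr => i _.
  rewrite coeval_coboundary tens_sumr !mulrz_suml; apply: eq_bigr => j _.
  rewrite tensMzr !mulrz_signD; apply: mulrz_sign_eq.
  by rewrite !(oddD, oddM) /=; case: (odd q); case: (odd p);
    case: (odd i); case: (odd j).
have -> : coeval s (coboundary (prism a b)) =
    (\sum_(i < p) \sum_(j < (p + q).+1)
      phi (bump j \o collapse q i) (bump j \o addn i)
        *~ (-1) ^+ (q + q.+1 * i + j)) *~ (-1) ^+ (p * q).
  have pq1 : (p + q).-1.+1 = (p + q)%N by lia.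
  rewrite coeval_coboundary pq1 exchange_big mulrz_suml; apply: eq_bigr => j _.
  rewrite coeval_prism // !mulrz_suml; apply: eq_bigr => i _.
  rewrite !mulrz_signD; apply: mulrz_sign_eq.
  by rewrite !(oddD, oddM) /=; case: (odd q); case: (odd p);
    case: (odd i); case: (odd j).
rewrite -!mulrzDl prism_identity // mulrzBl mulrz_signD.
rewrite coeval_swap_cup coeval_cup (@mulrz_sign_eq _ _ (_ + _) 0) //.
by rewrite oddD addbb.
Qed.

(** Only h(a (x) db) survives. Since db has degree 1, contracting a block changes nothing: the i-th
    summand is a(s) (x) (b(s_(i+1)) - b(s_i)), and the sum telescopes. *)
Lemma prism_homotopy0 p (a : cochain M p) (b : cochain N 0) :
  incl (pushforward (swapG N M) (cup b a)) - incl (cup a b) =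
  incl (prism a (coboundary b)) *~ (-1) ^+ p.
Proof.
have [c1 -> c1E] := incl_degree (pushforward (swapG N M) (cup b a))
  (addnC 0%N p).
have [c2 -> c2E] : exists2 c : cochain (tensor M N) (p + 0),
    incl (prism a (coboundary b)) = incl c &
    forall s, coeval s c = coeval s (prism a (coboundary b)).
  by apply: incl_degree; lia.
rewrite -!raddfMz -!raddfB; congr incl; apply: cochain_ext => s.
rewrite coevalB !coevalMz c1E c2E.
rewrite coeval_swap_cup coeval_cup coeval_prism // mulrz_signD.
rewrite (@mulrz_sign_opp _ _ _ 0); last by rewrite !oddD oddM /=; case: (odd p).
pose g i := tens (coeval s a) (coeval (s \o addn i) b).
rewrite mulr1z (eq_bigr (fun i : 'I_p => g i.+1 - g i)) => [|i _].
  rewrite -(big_mkord xpredT (fun i => g i.+1 - g i)).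
  by rewrite telescope_sumr // opprB.
rewrite (@mulrz_sign_eq _ _ _ 0) ?oddM // mulr1z coeval_coboundary.
rewrite 2!big_ord_recl big_ord0 addr0 mulr1z mulrN1z raddfB /g.
congr (tens _ _ - tens _ _);
  apply: coeval_eq => k kn; congr (s _);
    rewrite /= /collapse /bump; do ?case: ifP => ?; lia.
Qed.

(* For p = 0 the prism is an empty sum, so the convention h = 0 holds anyway. *)
Lemma homotopy_bilinearE p q (a : cochain M p) (b : cochain N q) :
  (0 < q)%N -> homotopy_bilinear a b = incl (prism a b).
Proof.
move=> q_gt0; rewrite /homotopy_bilinear q_gt0 andbT; case: posnP => // p0.
subst p; rewrite -(raddf0 (@incl _ (0 + q).-1)); congr incl.
apply: cochain_ext => s; rewrite coeval_prism // big_ord0 mul0rz.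
exact: raddf0.
Qed.

Lemma homotopy_formula p q (a : cochain M p) (b : cochain N q) :
  incl (pushforward (swapG N M) (cup b a)) *~ (-1) ^+ (p * q)
    - incl (cup a b) =
  homotopy (diff2 (tens (incl a) (incl b)))
    + diff (homotopy (tens (incl a) (incl b))).
Proof.
rewrite diff2_incl raddfD raddfMz /= !homotopyE.
have [q0 | q_gt0] := posnP q; last first.
  by rewrite !homotopy_bilinearE // diff_incl prism_homotopy.
subst q; rewrite (homotopy_bilinearE a) // /homotopy_bilinear !andbF.
by rewrite diff0 addr0 add0r muln0 mulr1z prism_homotopy0.
Qed.

End HomotopyFormula.

(** * Inhomogeneous coordinates *)

Section Inhomogeneous.
Context (G : groupType).

Lemma telescope_prodg (s : nat -> G) m n : (m <= n)%N ->
  \big[*%g/1%g]_(m <= k < n) ((s k)^-1 * s k.+1)%g = ((s m)^-1 * s n)%g.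
Proof.
move/subnKC <-; elim: (n - m)%N => [|k IHk].
  by rewrite addn0 big_geq // mulVg.
by rewrite addnS big_nat_recr ?leq_addr //= IHk -mulgA mulVKg.
Qed.

Let diffs n (s : nat -> G) := [tuple ((s i)^-1 * s i.+1)%g | i < n].

Let nth_diffs n s k : (k < n)%N ->
  nth 1%g (diffs n s) k = ((s k)^-1 * s k.+1)%g.
Proof. by move=> kn; rewrite (nth_mktuple _ _ (Ordinal kn)). Qed.

Let prod_diffs n s i j : (i <= j)%N -> (j <= n)%N ->
  \big[*%g/1%g]_(i <= k < j) nth 1%g (diffs n s) k = ((s i)^-1 * s j)%g.
Proof.
move=> ij jn; rewrite -telescope_prodg //; apply: eq_big_nat => k /andP[_ kj].
by rewrite nth_diffs // (leq_trans kj).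
Qed.

Lemma coeval_homogeneous (M : gmodType G) n (a : n.-tuple G -> M) s :
  coeval s (homogeneous a) = gact (s 0%N) (a (diffs n s)).
Proof.
rewrite /coeval [LHS]chain_liftE /homogeneous_fun vertexE //.
by congr (gact _ (a _)); apply: eq_from_tnth => i;
  rewrite !tnth_mktuple !vertexE // ltnW.
Qed.

(** In the coordinates s_k^-1 s_(k+1), the product over a block is s_i^-1 s_(i+q), the coordinate of
    the contracted edge given to a. The prefix product s_0^-1 s_i moves the base point of b from s_0
    to s_i. *)
Lemma prism_homogeneous (M N : gmodType G) p q
    (a : p.-tuple G -> M) (b : q.-tuple G -> N) : (0 < q)%N ->
  prism (homogeneous a) (homogeneous b) = homogeneous (inhomogeneous_prism a b).
Proof.
move=> q_gt0; apply: cochain_ext => s.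
rewrite coeval_prism // coeval_homogeneous /inhomogeneous_prism.
rewrite raddfMz raddf_sum.
congr (_ *~ _); apply: eq_bigr => i _; have ip := ltn_ord i.
rewrite !coeval_homogeneous raddfMz /= gact_tens; congr (tens _ _ *~ _).
  congr (gact _ (a _)); apply: eq_from_tnth => j; have jp := ltn_ord j.
  rewrite !tnth_mktuple -val_eqE /= /collapse.
  have [ji | ij | /= ->] := ltngtP j i.
  - by rewrite nth_diffs //; lia.
  - by rewrite nth_diffs; last lia; congr (_ * s _)%g; lia.
  - by rewrite prod_diffs; [|lia..]; congr (_ * s _)%g; lia.
rewrite prod_diffs; [|lia..].
rewrite -gactM mulVKg /= addn0; congr (gact _ (b _)).
apply: eq_from_tnth => j; have jq := ltn_ord j.
by rewrite !tnth_mktuple nth_diffs /= ?addnS //; lia.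
Qed.

End Inhomogeneous.

Theorem theorem3p8 (G : groupType) (M N : gmodType G) :
  exists h : {additive tensor (cochains M) (cochains N) ->
                cochains (tensor M N)},
    [/\ is_homotopy h,
        forall h' : {additive tensor (cochains M) (cochains N) ->
                       cochains (tensor M N)},
          is_homotopy h' -> h' =1 h,
        forall (p q : nat) (a : cochain M p) (b : cochain N q),
          incl (pushforward (swapG N M) (cup b a)) *~ (-1) ^+ (p * q)
            - incl (cup a b) =
          h (diff2 (tens (incl a) (incl b)))
            + diff (h (tens (incl a) (incl b)))
      & forall (p q : nat) (a : p.-tuple G -> M) (b : q.-tuple G -> N),
          (0 < p)%N -> (0 < q)%N ->
          h (tens (incl (homogeneous a)) (incl (homogeneous b))) =
          incl (homogeneous (inhomogeneous_prism a b))].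
Proof.
exists (@homotopy G M N); split.
- exact: homotopyP.
- by move=> h' h'P; apply: is_homotopy_unique h'P (@homotopyP G M N).
- exact: homotopy_formula.
move=> p q a b p_gt0 q_gt0.
by rewrite -prism_homogeneous // (homotopyP _ _).2.
Qed.
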